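(* Let $\beta_N\in(0,1)$, $N\in\mathbb N$, satisfy $\sum_{N=1}^\infty\beta_N<\infty$, and suppose the radii $\varepsilon_N(\beta_N)$ satisfy $\lim_{N\to\infty}\varepsilon_N(\beta_N)=0$. Let $\widehat g^*_{\text{noise},N}$ and $\widehat w^*_{\text{noise},N}\in\mathcal W$ denote the in-sample optimal value and an optimal solution of the noisy-data DRO problem $$\sup_{w\in\mathcal W}\ \inf_{\mathbb Q\in\mathcal B_{\varepsilon_N(\beta_N),\mathbb O}(\widehat{\mathbb F}^\star)}\mathbb E^{\mathbb Q}[U(\langle w,X\rangle)]$$ with $N$ samples, and let $g^*_{SO}:=\sup_{w\in\mathcal W}\mathbb E^{\mathbb F}[U(\langle w,X\rangle)]$. Suppose that the function $x\mapsto U(\langle w,x\rangle)$ is $L$-Lipschitz continuous on $\mathfrak X$ for $w\in\mathcal W$. Then: (i) with probability one $\widehat g^*_{\text{noise},N}$ converges to $g^*_{SO}$, i.e. $\mathbb P^{\star\infty}\{\lim_{N\to\infty}\widehat g^*_{\text{noise},N}=g^*_{SO}\}=1$; (ii) in addition, for the compact feasible set $\mathcal W$, with probability one any accumulation point of the sequence $\{\widehat w^*_{\text{noise},N}\}_{N\in\mathbb N}$ is an optimal solution of $\sup_{w\in\mathcal W}\mathbb E^{\mathbb F}[U(\langle w,X\rangle)]$.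
   Context: Setting. $\mathfrak X=\{x\in\mathbb R^n: x_{\min}\le x\le x_{\max}\}$ (componentwise) is a compact box, and $\mathfrak X^\star\subseteq\mathbb R^n$ is a compact convex set with $\mathfrak X\subseteq\mathfrak X^\star$. $\mathcal M(S)$ denotes the set of probability measures supported on $S$. The latent random vector $X$ has unknown distribution $\mathbb F\in\mathcal M(\mathfrak X)$. The noise is additive: $X^\star=X+E$ with $E$ independent of $X$ and $E\sim\mathbb F_E$; the noise kernel is $\mathbb O(A\mid x)=\mathbb P(X^\star\in A\mid X=x)=\mathbb F_E(A-x)$, where $A-x=\{z: z+x\in A\}$, and it is known. The noise operator $T_{\mathbb O}:\mathcal M(\mathfrak X)\to\mathcal M(\mathfrak X^\star)$ is $(T_{\mathbb O}(\mathbb Q))(A)=\int_{\mathfrak X}\mathbb O(A\mid x)\,d\mathbb Q(x)$ (in particular noisy observations of latent laws on $\mathfrak X$ are supported on the compact set $\mathfrak X^\star$); $\mathbb F^\star=T_{\mathbb O}(\mathbb F)$ is the distribution of the noisy observation. Samples. $\widehat X_1^\star,\widehat X_2^\star,\dots$ are i.i.d. from $\mathbb F^\star$; $\mathbb P^{\star N}$ is the $N$-fold product of $\mathbb F^\star$ and $\mathbb P^{\star\infty}$ the infinite product; $\widehat{\mathbb F}^\star=\frac1N\sum_{j=1}^N\delta_{\widehat X^\star_j}$ is the noisy empirical distribution of the first $N$ samples. Wasserstein metric. $d(\mathbb Q,\mathbb Q')$ is the order-1 Wasserstein distance for the $\ell_1$-norm $\|\cdot\|$: $d(\mathbb Q,\mathbb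 Q')=\min_\Pi\mathbb E^{(\xi,\xi')\sim\Pi}\|\xi-\xi'\|$ over couplings $\Pi$ of $\mathbb Q,\mathbb Q'$. Lipschitz continuity on $\mathfrak X$ means $|f(x)-f(x')|\le L\|x-x'\|$ for all $x,x'\in\mathfrak X$. Ambiguity set. For a radius $\varepsilon$, $\mathcal B_{\varepsilon,\mathbb O}(\widehat{\mathbb F}^\star)=\{\mathbb Q\in\mathcal M(\mathfrak X): d(T_{\mathbb O}(\mathbb Q),\widehat{\mathbb F}^\star)\le\varepsilon\}$. Radius. $\varepsilon_N(\beta)$ is the smallest radius of a Wasserstein ball centered at $\widehat{\mathbb F}^\star$ that contains $\mathbb F^\star$ with confidence at least $1-\beta$, i.e. the smallest $\varepsilon$ with $\mathbb P^{\star N}\{d(\mathbb F^\star,\widehat{\mathbb F}^\star)\le\varepsilon\}\ge 1-\beta$. $\mathcal W\subseteq\mathbb R^n$ is a compact set of decisions and $U:\mathbb R\to\mathbb R$ is continuous, concave and nondecreasing. Infima over the empty set are $+\infty$. *)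

(* Defs.v *)
From HB Require Import structures.
From mathcomp Require Import all_boot all_order all_algebra finmap.
From mathcomp Require Import all_classical all_reals all_analysis.

Set Implicit Arguments.
Unset Strict Implicit.
Unset Printing Implicit Defensive.

Import Order.TTheory GRing.Theory Num.Theory.
Import numFieldNormedType.Exports.

Local Open Scope classical_set_scope.
Local Open Scope ring_scope.

(* R^n is 'rV[R]_n with its Borel sigma-algebra; the library puts a topology but
   no measurable structure on matrices. *)
Section borel_rV.
Context (R : realType) (n : nat).

Let borel : set_system 'rV[R]_n := <<s (@open 'rV[R]_n) >>.

Let borel0 : borel set0. Proof. exact: sigma_algebra0. Qed.

Let borelC A : borel A -> borel (~` A). Proof. exact: sigma_algebraC. Qed.

Let borel_bigcup (F : (set 'rV[R]_n)^nat) :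
  (forall i, borel (F i)) -> borel (\bigcup_i F i).
Proof. exact: sigma_algebra_bigcup. Qed.

HB.instance Definition _ := @isMeasurable.Build default_measure_display
  'rV[R]_n borel borel0 borelC borel_bigcup.

End borel_rV.

Section euclidean.
Context (R : realType) (n : nat).
Implicit Types (v w x : 'rV[R]_n).

Definition l1norm v : R := \sum_(i < n) `|v 0 i|.

Definition dotp w x : R := \sum_(i < n) w 0 i * x 0 i.

Definition box (xmin xmax : 'rV[R]_n) : set 'rV[R]_n :=
  [set x | forall i, xmin 0 i <= x 0 i <= xmax 0 i].

(* The norm of 'rV[R]_n in the library is the sup norm, so its Lipschitz
   predicate does not apply to l1norm. *)
Definition lipschitz_l1 (L : R) (S : set 'rV[R]_n) (f : 'rV[R]_n -> R) :=
  forall x x', S x -> S x' -> `|f x - f x'| <= L * l1norm (x - x').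

End euclidean.

Definition prob_on {d} {T : measurableType d} {R : realType} (S : set T) :
  set (probability T R) := [set Q : probability T R | Q S = 1%E].

Definition independent_seq {d d'} {T : measurableType d}
    {T' : measurableType d'} {R : realType} (P : probability T R)
    (X : nat -> {RV P >-> T'}) :=
  forall (J : {fset nat}) (A : nat -> set T'),
    (forall j, j \in J -> measurable (A j)) ->
    (P (\bigcap_(j in [set` J]) (X j @^-1` A j)) =
     \prod_(j <- J) P (X j @^-1` A j))%E.

(* mu is only given as a set function: it is compared with the law of X j on
   measurable sets. *)
Definition iid_from {d d'} {T : measurableType d} {T' : measurableType d'}
    {R : realType} (P : probability T R) (X : nat -> {RV P >-> T'})
    (mu : set T' -> \bar R) :=
  independent_seq X /\
  forall j A, measurable A -> distribution P (X j) A = mu A.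

(* Law of the first N terms of X : nat -> T, i.e. of X 0, ..., X N.-1. *)
Definition empirical {d} {T : measurableType d} {R : realType}
    (X : nat -> T) (N : nat) : set T -> \bar R :=
  fun A => ((N%:R^-1)%:E * \sum_(j < N) \d_(X j) A)%E.

Section wasserstein.
Context (R : realType) (n : nat).
Local Notation Rn := 'rV[R]_n.

Definition couplings (mu nu : set Rn -> \bar R) : set (probability (Rn * Rn)%type R) :=
  [set Pi : probability (Rn * Rn)%type R | forall A, measurable A ->
    Pi (fst @^-1` A) = mu A /\ Pi (snd @^-1` A) = nu A].

Definition wasserstein (mu nu : set Rn -> \bar R) : \bar R :=
  ereal_inf [set (\int[Pi]_z (l1norm (z.1 - z.2))%:E)%E | Pi in couplings mu nu].

End wasserstein.

Section noise.
Context (R : realType) (n : nat).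
Local Notation Rn := 'rV[R]_n.
Variables (FE : probability Rn R) (S : set Rn).

Definition noise_kernel (A : set Rn) (x : Rn) : \bar R :=
  FE [set z | A (z + x)].

Definition noise_op (Q : probability Rn R) : set Rn -> \bar R :=
  fun A => (\int[Q]_(x in S) noise_kernel A x)%E.

Definition ambiguity (eps : R) (mu : set Rn -> \bar R) : set (probability Rn R) :=
  [set Q : probability Rn R | prob_on S Q /\ (wasserstein (noise_op Q) mu <= eps%:E)%E].

End noise.

(* eps is the smallest radius for which the Wasserstein ball around the
   empirical law of N samples contains mu with probability at least 1 - beta. *)
Definition is_radius {d} {Om : measurableType d} {R : realType} {n : nat}
    (P : probability Om R) (X : nat -> Om -> 'rV[R]_n)
    (mu : set 'rV[R]_n -> \bar R) (N : nat) (beta eps : R) :=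
  let radii := [set e : R |
    ((1 - beta)%:E <=
     P [set om | (wasserstein mu (empirical (X ^~ om) N) <= e%:E)%E])%E] in
  radii eps /\ lbound radii eps.

Section optimization.
Context (R : realType) (n : nat).
Local Notation Rn := 'rV[R]_n.
Variable U : R -> R.

Definition expected_utility (Q : probability Rn R) (w : Rn) : \bar R :=
  'E_Q[fun x => U (dotp w x)].

Definition worst_case_utility (B : set (probability Rn R)) (w : Rn) : \bar R :=
  ereal_inf [set expected_utility Q w | Q in B].

Definition opt_value (W : set Rn) (f : Rn -> \bar R) : \bar R :=
  ereal_sup [set f w | w in W].

Definition opt_sols (W : set Rn) (f : Rn -> \bar R) : set Rn :=
  [set w | W w /\ f w = opt_value W f].

End optimization.

(* Main.v *)
(* All the laws involved are carried by bounded sets, so convergence of the noisy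
   laws T(Q) in Wasserstein distance gives convergence of the moments of <w, X + E>.
   Expanding (<w, X> + <w, E>)^k shows that the moments of <w, X> are determined by
   those of <w, X + E> and <w, E> through a triangular system with unit diagonal;
   hence they converge too, uniformly in w, and by the Weierstrass approximation
   theorem so do the expectations of U(<w, X>).  By Borel-Cantelli, almost surely F
   eventually belongs to the ambiguity set, all of whose noisy laws are then close to
   T(F); so the worst-case objective converges to the true one uniformly in w, which
   yields both claims. *)

(* The obstacle is to undo the noise: closeness of noisy laws has to yield closeness of latent laws,
   with a modulus independent of the laws, of the centre of the ball and of the decision. Moments
   give such a modulus because the noise moments are common to both latent laws, and the unit
   diagonal of the system is the noise moment of order 0, so each step of the recursion loses only
   an explicit constant. Boundedness of the noise is extracted from the support condition on noisy
   laws, applied to a point mass in the box. Borel-Cantelli needs measurable confidence events; they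
   come from the Lipschitz dependence of the Wasserstein distance on the sample points, proved by
   modifying couplings. *)
From HB Require Import structures.
Require Import Defs.
From mathcomp Require Import all_boot all_order all_algebra.
From mathcomp Require Import ring lra.
From mathcomp Require Import all_classical all_reals all_analysis.
From mathcomp Require Import measurable_realfun.
Set Implicit Arguments.
Unset Strict Implicit.
Unset Printing Implicit Defensive.
Import Order.TTheory GRing.Theory Num.Theory.
Import numFieldNormedType.Exports.
Local Open Scope classical_set_scope.
Local Open Scope ring_scope.

(** * Weierstrass approximation *)

Section weierstrass.
Context {R : realType}.
Implicit Types (f : R -> R) (g h : nat -> R).

(* The Bernstein polynomial \sum_k g k * 'C(m, k) * 'X^k * (1 - 'X)^(m - k), i.e. the
   mean of g under the binomial law, by conditioning on the first trial. *)
Fixpoint bernstein (m : nat) g : {poly R} :=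
  if m is m'.+1 then
    'X * bernstein m' (fun k => g k.+1) + (1 - 'X) * bernstein m' g
  else (g 0%N)%:P.

Lemma horner_bernsteinS m g x : (bernstein m.+1 g).[x] =
  x * (bernstein m (fun k => g k.+1)).[x] + (1 - x) * (bernstein m g).[x].
Proof. by rewrite /= !hornerE. Qed.

(** On [0, 1] the recursion takes convex combinations, so the operator is positive and fixes
    constants. *)
Lemma bernstein_dist m g h c x : 0 <= x <= 1 ->
  (forall k, (k <= m)%N -> `|g k - c| <= h k) ->
  `|(bernstein m g).[x] - c| <= (bernstein m h).[x].
Proof.
move=> /andP[x0 x1]; elim: m g h => [|m IH] g h gh.
  by rewrite /= !hornerC; apply: gh.
rewrite !horner_bernsteinS.
set a := (bernstein m (fun k => g k.+1)).[x].
set b := (bernstein m g).[x].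
have -> : x * a + (1 - x) * b - c = x * (a - c) + (1 - x) * (b - c) by ring.
have x1' : 0 <= 1 - x by rewrite subr_ge0.
rewrite (le_trans (ler_normD _ _))// lerD// normrM ger0_norm// ler_wpM2l//.
- by apply: IH => k km; apply: gh.
- by apply: IH => k km; apply: gh; rewrite ltnW.
Qed.

(** This is the binomial variance [m * x * (1 - x)]. The shift [c] makes the induction go through: a
    failed first trial turns [c] into [c - x], a successful one into [c + 1 - x]. *)
Lemma bernstein_variance m a b c x :
  (bernstein m (fun k => a + b * (k%:R + c - m%:R * x) ^+ 2)).[x] =
  a + b * (c ^+ 2 + m%:R * (x * (1 - x))).
Proof.
have E : forall m c e, e = c - m%:R * x ->
    (bernstein m (fun k => a + b * (k%:R + e) ^+ 2)).[x] =
    a + b * (c ^+ 2 + m%:R * (x * (1 - x))).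
  elim=> [|{}m IH] {}c e ce.
    by rewrite /= hornerC ce; ring.
  rewrite horner_bernsteinS (IH (c - x)); last by rewrite ce -natr1; ring.
  rewrite (_ : (fun k : nat => _) = (fun k => a + b * (k%:R + (e + 1)) ^+ 2)).
    rewrite (IH (c + 1 - x)); last by rewrite ce -natr1; ring.
    by rewrite -natr1; ring.
  by apply/funext => k; rewrite -natr1; ring.
rewrite -(E m c (c - m%:R * x))//; congr (bernstein _ _).[_].
by apply/funext => k; rewrite addrA.
Qed.

(** Heine-Cantor with only [x] confined to the segment, so users need not locate [y]. Half of the
    local radius pays for reaching a nearby point, half for the move from that point. *)
Lemma continuous_segment_unif f (a b e : R) : continuous f -> 0 < e ->
  exists2 r : R, 0 < r & forall x y : R, a <= x <= b -> `|x - y| < r -> `|f x - f y| < e.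
Proof.
move=> cf e0.
have /compact_near_coveringP ab : compact `[a, b] by exact: segment_compact.
have [|r /= r0 H] := ab R 0^'+
    (fun r x => forall y, `|x - y| < r -> `|f x - f y| < e) _.
  move=> x _; have /cvgrPdist_lt/(_ (e / 2)) := cf x.
  rewrite divr_gt0// => /(_ isT) /nbhs_ballP[r /= r0 fr].
  exists (ball x (r / 2), [set s | s < r / 2]) => /=.
    split; first by apply: nbhsx_ballx; rewrite divr_gt0.
    by apply: nbhs_right_lt; rewrite divr_gt0.
  move=> [y s] [/= xy sr] z yz.
  have xy' : `|x - y| < r / 2 by [].
  have fy : `|f x - f y| < e / 2.
    by apply: fr; rewrite /ball /= (lt_le_trans xy')//; lra.
  have fz : `|f x - f z| < e / 2.
    apply: fr; rewrite /ball /=.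
    have -> : x - z = (x - y) + (y - z) by ring.
    by rewrite (le_lt_trans (ler_normD _ _))//; lra.
  have -> : f y - f z = (f x - f z) - (f x - f y) by ring.
  by rewrite (le_lt_trans (ler_normB _ _))//; lra.
exists (r / 2); first by rewrite divr_gt0.
move=> x y xab xy; apply: (H (r / 2)) => //=.
  by rewrite sub0r normrN gtr0_norm ?divr_gt0//; lra.
by rewrite divr_gt0.
Qed.

Lemma continuous_segment_bounded f (a b : R) : continuous f ->
  exists2 K : R, 0 < K & forall x : R, a <= x <= b -> `|f x| <= K.
Proof.
move=> cf.
have [M [_ fM]] : bounded_set (f @` `[a, b]).
  apply: compact_bounded; apply: continuous_compact; last exact: segment_compact.
  exact: continuous_subspaceT.
exists (`|M| + 1); first by rewrite ltr_wpDl.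
move=> x xab; apply: (fM (`|M| + 1)); first by rewrite (le_lt_trans (ler_norm _))// ltrDl.
by exists x.
Qed.

Lemma weierstrass01 f (e : R) : continuous f -> 0 < e ->
  exists p : {poly R}, forall x : R, 0 <= x <= 1 -> `|f x - p.[x]| <= e.
Proof.
move=> cf e0.
have e20 : 0 < e / 2 by rewrite divr_gt0.
have [r r0 fr] := continuous_segment_unif 0 1 cf e20.
have [K K0 fK] := continuous_segment_bounded 0 1 cf.
(* Chebyshev's argument: at distance at least [r] the oscillation [2 * K] is at most
   [A * (s - x) ^+ 2], hence [e / 2 + A * (s - x) ^+ 2] dominates everywhere. Its binomial mean is
   at most [e / 2 + A / m], which dictates [m]. *)
pose A := 2 * K / r ^+ 2.
have A0 : 0 < A by rewrite divr_gt0 ?mulr_gt0 ?exprn_gt0.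
pose m := (Num.truncn (A / (e / 2))).+1.
have m0 : 0 < m%:R :> R by rewrite ltr0n.
have Am : A / m%:R <= e / 2.
  by rewrite ler_pdivrMr// mulrC -ler_pdivrMr//; apply/ltW/truncnS_gt.
exists (bernstein m (fun k => f (k%:R / m%:R))) => x /[dup] x01 /andP[x0 x1].
rewrite distrC; apply: le_trans (_ : (bernstein m
  (fun k => e / 2 + (A / m%:R ^+ 2) * (k%:R + 0 - m%:R * x) ^+ 2)).[x] <= _).
  apply: bernstein_dist => // k km.
  have k01 : 0 <= (k%:R / m%:R : R) <= 1.
    apply/andP; split; first by rewrite divr_ge0 ?ler0n.
    by rewrite ler_pdivrMr// mul1r ler_nat.
  set s := k%:R / m%:R.
  have -> : e / 2 + A / m%:R ^+ 2 * (k%:R + 0 - m%:R * x) ^+ 2 =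
            e / 2 + A * (s - x) ^+ 2.
    by rewrite /s; field; rewrite gt_eqF.
  have As0 : 0 <= A * (s - x) ^+ 2 by rewrite mulr_ge0 ?sqr_ge0// ltW.
  have [sx|sx] := ltP `|s - x| r.
    by rewrite (le_trans (ltW (fr _ _ k01 sx)))// lerDl.
  rewrite (le_trans (ler_normB _ _))// (le_trans (lerD (fK _ k01) (fK _ x01)))//.
  have : r ^+ 2 <= (s - x) ^+ 2.
    by rewrite -(real_normK (num_real (s - x))) ler_pXn2r ?nnegrE// ltW.
  rewrite -(ler_pM2l A0) {1}/A divfK ?gt_eqF ?exprn_gt0//; lra.
rewrite bernstein_variance expr0n add0r.
have -> : A / m%:R ^+ 2 * (m%:R * (x * (1 - x))) = A / m%:R * (x * (1 - x)).
  by field; rewrite gt_eqF.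
have : A / m%:R * (x * (1 - x)) <= A / m%:R.
  by rewrite ler_piMr ?divr_ge0 ?ltW//; nra.
lra.
Qed.

Lemma weierstrass_segment f (M e : R) : continuous f -> 0 < M -> 0 < e ->
  exists p : {poly R}, forall x : R, `|x| <= M -> `|f x - p.[x]| <= e.
Proof.
move=> cf M0 e0.
have cg : continuous (fun t : R => f (M * (2 * t - 1))).
  move=> t; apply: continuous_comp; last exact: cf.
  apply: cvgM; first exact: cvg_cst.
  by apply: cvgB; [apply: cvgM; [exact: cvg_cst|exact: cvg_id]|exact: cvg_cst].
have [p fp] := weierstrass01 cg e0.
exists (p \Po ((2 * M)^-1 *: 'X + (2^-1)%:P)) => x xM.
rewrite horner_comp !hornerE.
have t01 : 0 <= (2 * M)^-1 * x + 2^-1 <= 1.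
  move: xM; rewrite ler_norml => /andP[a b].
  have -> : (2 * M)^-1 * x + 2^-1 = (x + M) / (2 * M) by field; rewrite gt_eqF.
  rewrite divr_ge0 ?ler_pdivrMr ?mulr_gt0//=; lra.
have := fp _ t01.
by rewrite (_ : M * _ = x)//; field; rewrite gt_eqF.
Qed.

End weierstrass.

(** * The Borel sigma-algebra of row vectors *)

Section borel_rV.
Context {R : realType}.

(** An open set is a countable union of balls with rational centres and radii [k.+1%:R^-1], and a
    ball of the sup norm is a finite intersection of coordinate conditions. *)
Lemma measurable_rV d (T : measurableType d) n (f : T -> 'rV[R]_n) :
  (forall i, measurable_fun setT (fun t => f t 0 i)) -> measurable_fun setT f.
Proof.
move=> mf; apply: (@measurability _ _ _ _ _ _ (@open 'rV[R]_n)) => //.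
move=> _ [V oV <-]; rewrite setTI.
pose c (q : 'rV[rat]_n) : 'rV[R]_n := map_mx ratr q.
pose G (qk : 'rV[rat]_n * nat) := [set t |
  ball (c qk.1) qk.2.+1%:R^-1 `<=` V /\ ball (c qk.1) qk.2.+1%:R^-1 (f t)].
suff -> : f @^-1` V = \bigcup_qk G qk.
  apply: countable_bigcupT_measurable => // -[q k]; rewrite /G /=.
  have [qV|nqV] := pselect (ball (c q) k.+1%:R^-1 `<=` V); last first.
    by rewrite (_ : [set _ | _] = set0)//; apply/seteqP; split => t // [].
  rewrite (_ : [set _ | _] = \bigcap_(i : 'I_n)
      ((fun t => f t 0 i) @^-1` ball (c q 0 i) k.+1%:R^-1)).
    apply: fin_bigcap_measurable => // i _; rewrite -[X in measurable X]setTI.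
    by apply: mf => //; exact: measurable_ball.
  apply/seteqP; split => [t [_ [_ qt]] i _|t qt]; first exact: qt.
  split => //; split => [|i j]; first by rewrite invr_gt0.
  by rewrite (ord1 i); exact: qt.
apply/seteqP; split => [t Vt|t [qk _ []]]; last exact.
have /nbhs_ballP[e /= e0 eV] : nbhs (f t) V by exact: open_nbhs_nbhs.
(* With radius below [e / 2], any such ball that contains [f t] stays within distance [e] of it,
   hence inside [V]. *)
pose k := Num.truncn (e / 2)^-1.
have ke : k.+1%:R^-1 < e / 2.
  by rewrite invf_plt ?posrE ?divr_gt0//; exact: truncnS_gt.
have k0 : 0 < k.+1%:R^-1 :> R by rewrite invr_gt0.
have [q qP] : exists q : 'rV[rat]_n, ball (c q) k.+1%:R^-1 (f t).
  have /choice[g gP] : forall i, exists q : rat, `|ratr q - f t 0 i| < k.+1%:R^-1.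
    move=> i; have /rat_in_itvoo[q] : f t 0 i < f t 0 i + k.+1%:R^-1.
      by rewrite ltrDl.
    rewrite in_itv /= => /andP[h1 h2]; exists q.
    by rewrite ger0_norm ?subr_ge0 ?ltrBlDl// ltW.
  exists (\row_i g i); split => // i j.
  by rewrite !mxE (ord1 i); exact: gP.
exists (q, k) => //; split => //= y qy; apply: eV.
have : ball (f t) (k.+1%:R^-1 + k.+1%:R^-1) y.
  by apply: ball_triangle qy; exact: ball_sym.
apply: le_ball; rewrite [leRHS](splitr e); apply: lerD; exact: ltW.
Qed.

Lemma measurable_coord n (i : 'I_n) :
  measurable_fun setT (fun v : 'rV[R]_n => v 0 i).
Proof.
apply: (measurability _ (RGenOpens.measurableE R)).
move=> _ [_ [a [b ->] <-]]; rewrite setTI; apply: sub_sigma_algebra.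
move: (@interval_open R (BRight a) (BLeft b) isT isT).
by apply: (proj1 (continuousP _)); exact: coord_continuous.
Qed.

Lemma measurable_coordT d (T : measurableType d) n (f : T -> 'rV[R]_n) i :
  measurable_fun setT f -> measurable_fun setT (fun t => f t 0 i).
Proof. by move=> mf; exact: (measurableT_comp (measurable_coord i)). Qed.

Lemma measurable_addrV d (T : measurableType d) n (f g : T -> 'rV[R]_n) :
  measurable_fun setT f -> measurable_fun setT g ->
  measurable_fun setT (fun t => f t + g t).
Proof.
move=> mf mg; apply: measurable_rV => i.
under eq_fun do rewrite mxE.
by apply: measurable_funD; exact: measurable_coordT.
Qed.

Lemma measurable_l1norm d (T : measurableType d) n (f g : T -> 'rV[R]_n) :
  measurable_fun setT f -> measurable_fun setT g ->
  measurable_fun setT (fun t => l1norm (f t - g t)).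
Proof.
move=> mf mg; apply: measurable_sum => i.
under eq_fun do rewrite !mxE.
apply: measurableT_comp => //.
by apply: measurable_funB; exact: measurable_coordT.
Qed.

Lemma measurable_dotp n (w : 'rV[R]_n) : measurable_fun setT (dotp w).
Proof.
apply: measurable_sum => i; apply: measurable_funM => //.
exact: measurable_coord.
Qed.

Lemma closed_measurable_rV n (A : set 'rV[R]_n) : closed A -> measurable A.
Proof.
move=> cA; rewrite -[A]setCK; apply: measurableC; apply: sub_sigma_algebra.
exact: closed_openC.
Qed.

Lemma measurable_set1_rV n (x : 'rV[R]_n) : measurable [set x].
Proof.
apply: closed_measurable_rV.
by apply: compact_closed; [exact: norm_hausdorff|exact: compact_set1].
Qed.

Lemma measurable_box n (a b : 'rV[R]_n) : measurable (box a b).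
Proof.
rewrite (_ : box a b = \bigcap_(i : 'I_n)
    ((fun v : 'rV[R]_n => v 0 i) @^-1` `[a 0 i, b 0 i])).
  apply: fin_bigcap_measurable => // i _; rewrite -[X in measurable X]setTI.
  exact: measurable_coord.
apply/seteqP; split => [x xab i _ /=|x xab i]; first by rewrite in_itv; exact: xab.
by have := xab i I; rewrite /= in_itv.
Qed.

End borel_rV.

(** * Couplings with empirical laws *)

Section integral_complements.
Context d (T : measurableType d) (R : realType).

Lemma ge0_integral_mrestr (mu : {measure set T -> \bar R}) (D : set T)
    (mD : measurable D) (f : T -> \bar R) :
  measurable_fun setT f -> (forall x, 0 <= f x)%E ->
  (\int[mrestr mu mD]_x f x = \int[mu]_(x in D) f x)%E.
Proof.
move=> mf f0.
rewrite (@ge0_negligible_integral _ _ _ _ setT (~` D))//; last 2 first.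
- exact: measurableC.
- by rewrite /= /mrestr setIC setICr measure0.
rewrite setTD setCK; apply: eq_measure_integral => A mA AD.
by rewrite /= /mrestr setIidl.
Qed.

Lemma probability1_setC (Q : probability T R) (A : set T) :
  measurable A -> Q A = 1%E -> Q (~` A) = 0%E.
Proof. by move=> mA QA; rewrite probability_setC// QA subee. Qed.

End integral_complements.

Section empirical.
Context d (T : measurableType d) (R : realType).
Implicit Types (x : nat -> T) (N : nat).

(** Sample points may coincide, so an atom has [N%:R^-1] times this mass. *)
Definition multiplicity (x : nat -> T) (N : nat) (y : T) : nat :=
  #|[pred j : 'I_N | `[< x j = y >]]|.

Lemma multiplicity_gt0 x N j : (j < N)%N -> (0 < multiplicity x N (x j))%N.
Proof.
move=> jN; apply/card_gt0P; exists (Ordinal jN).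
by rewrite unfold_in /=; apply/asboolP.
Qed.

Lemma empirical_set1 x N y :
  empirical x N [set y] = (N%:R^-1 * (multiplicity x N y)%:R : R)%:E.
Proof.
rewrite /empirical EFinM; congr (_ * _)%E.
rewrite /multiplicity -sum1_card natr_sum -sumEFin [RHS]big_mkcond /=.
apply: eq_bigr => j _; rewrite diracE [in RHS]unfold_in /=.
case: ifPn => [/asboolP ->|/asboolP xy]; first by rewrite mem_set.
by rewrite memNset.
Qed.

Lemma empirical_range x N : (0 < N)%N -> empirical x N (x @` `I_N) = 1%E :> \bar R.
Proof.
move=> N0; rewrite /empirical.
rewrite (eq_bigr (fun=> 1%E)); last first.
  move=> j _; rewrite diracE mem_set//; exists j => //=.
rewrite sumEFin big_const_ord iter_addr addr0 -EFinM mulVf//.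
by rewrite pnatr_eq0 -lt0n.
Qed.

End empirical.

(** * Moving the second marginal of a coupling from one empirical law to another *)

Section gluing.
Context (R : realType) (n : nat).
Local Notation Rn := 'rV[R]_n.
Variables (mu : set Rn -> \bar R) (N : nat) (x y : nat -> Rn).
Variable Pi : probability (Rn * Rn)%type R.
Hypotheses (N0 : (0 < N)%N) (PiP : couplings mu (empirical x N) Pi).

Let fiber j : set (Rn * Rn) := snd @^-1` [set x j].

Let mfiber j : measurable (fiber j).
Proof.
rewrite -[X in measurable X]setTI; apply: measurable_snd => //.
exact: measurable_set1_rV.
Qed.

Let c j : R := (multiplicity x N (x j))%:R^-1.

Let c_ge0 j : 0 <= c j. Proof. by rewrite invr_ge0. Qed.

Let Pi_fiber j : Pi (fiber j) = (N%:R^-1 * (multiplicity x N (x j))%:R : R)%:E.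
Proof.
by have [_ ->] := PiP (measurable_set1_rV (x j)); rewrite empirical_set1.
Qed.

Let range_meas : measurable (x @` `I_N).
Proof.
rewrite (_ : _ @` _ = \bigcup_(j in `I_N) [set x j]).
  by apply: fin_bigcup_measurable => // j _; exact: measurable_set1_rV.
by rewrite bigcup_imset1.
Qed.

(** Fibers of equal sample points coincide: a point over [x j] is counted [multiplicity] times,
    which the weights [c j] compensate. Points over no sample value are [Pi]-null. *)
Lemma integral_fibers (h : Rn * Rn -> \bar R) :
  measurable_fun setT h -> (forall z, 0 <= h z)%E ->
  (\int[Pi]_z h z =
   \sum_(j < N) (c j)%:E * \int[Pi]_(z in fiber j) h z)%E.
Proof.
move=> mh h0.
have mhj j : measurable_fun setT (h \_ (fiber j)).
  by apply/(measurable_restrictT _ (mfiber j)); exact: measurable_funTS.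
have hj0 j z : (0 <= (h \_ (fiber j)) z)%E by apply: erestrict_ge0 => ? _; exact: h0.
transitivity (\int[Pi]_z \sum_(j < N) (c j)%:E * (h \_ (fiber j)) z)%E.
  apply: ge0_ae_eq_integral => //.
  - apply: emeasurable_sum => j _; exact: measurable_funeM.
  - by move=> z _; apply: sume_ge0 => j _; rewrite mule_ge0 ?lee_fin.
  exists (snd @^-1` (~` (x @` `I_N))); split.
  - by rewrite -[X in measurable X]setTI; apply: measurable_snd => //; exact: measurableC.
  - apply: (@probability1_setC _ _ _ Pi (snd @^-1` (x @` `I_N))).
      by rewrite -[X in measurable X]setTI; exact: measurable_snd.
    by have [_ ->] := PiP range_meas; rewrite empirical_range.
  move=> z /= + [j jN xz]; apply => _.
  rewrite (eq_bigr (fun i : 'I_N => if `[< x i = z.2 >] then (c j)%:E * h z else 0)%E).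
    rewrite -big_mkcond /= -ge0_sume_distrl//; last first.
      by move=> i _; rewrite lee_fin.
    rewrite sumEFin sumr_const -[X in X%:E]mulr_natr.
    rewrite (_ : #|_| = multiplicity x N (x j)); last first.
      by apply: eq_card => i; rewrite !unfold_in /= xz.
    by rewrite mulVf ?mul1e// pnatr_eq0 -lt0n multiplicity_gt0.
  move=> i _; rewrite /patch; case: ifPn.
    by rewrite inE /fiber /= => zi; rewrite asboolT// /c -zi -xz.
  rewrite notin_setE /fiber /= => zi; rewrite asboolF ?mule0//.
  by move=> e; apply: zi.
rewrite ge0_integral_sum//; last 2 first.
- by move=> j; exact: measurable_funeM.
- by move=> j z _; rewrite mule_ge0 ?lee_fin.
apply: eq_bigr => j _; rewrite ge0_integralZl//; last by rewrite lee_fin.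
by rewrite -integral_mkcond.
Qed.

Let relabel j (z : Rn * Rn) : Rn * Rn := (z.1, y j).

Let mrelabel j : measurable_fun setT (relabel j).
Proof. by apply: measurable_fun_pair => //; exact: measurable_fst. Qed.

(** Each piece has mass [N%:R^-1], whatever the multiplicity of [x j]. *)
Let piece j : {measure set (Rn * Rn) -> \bar R} :=
  mscale (NngNum (c_ge0 j))
    (measure_function_pushforward__canonical__measure_function_Measure
       (mrestr Pi (mfiber j)) (mrelabel j)).

Let glued := msum piece N.

Let gluedE A : glued A =
  (\sum_(j < N) (c j)%:E * Pi (relabel j @^-1` A `&` fiber j))%E.
Proof. by []. Qed.

Let glued_ge0_integral (h : Rn * Rn -> \bar R) :
  measurable_fun setT h -> (forall z, 0 <= h z)%E ->
  (\int[glued]_z h z =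
   \sum_(j < N) (c j)%:E * \int[Pi]_(z in fiber j) h (relabel j z))%E.
Proof.
move=> mh h0; rewrite ge0_integral_measure_sum//; apply: eq_bigr => j _.
rewrite ge0_integral_mscale//; congr (_ * _)%E.
rewrite ge0_integral_pushforward//= preimage_setT.
rewrite ge0_integral_mrestr//.
by apply: measurableT_comp.
Qed.

Let glued_fst A : measurable A -> glued (fst @^-1` A) = mu A.
Proof.
move=> mA; have [<- _] := PiP mA.
have mA1 : measurable (fst @^-1` A : set (Rn * Rn)).
  by rewrite -[X in measurable X]setTI; exact: measurable_fst.
rewrite gluedE -[in RHS](setIT (fst @^-1` A)) -integral_indic//.
rewrite integral_fibers//; last first.
  by apply/measurable_EFinP; exact: measurable_indic.
by apply: eq_bigr => j _; rewrite integral_indic.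
Qed.

Let glued_snd A : measurable A -> glued (snd @^-1` A) = empirical y N A.
Proof.
move=> mA; rewrite gluedE /empirical.
rewrite ge0_sume_distrr//; apply: eq_bigr => j _; rewrite diracE.
have [/[!inE] yA|/negP yA] := boolP (y j \in A).
  rewrite (_ : _ `&` _ = fiber j); last first.
    by apply/seteqP; split => [z []|z zj]//; split.
  rewrite Pi_fiber mule1 -EFinM mulrCA mulVf ?mulr1//.
  by rewrite pnatr_eq0 -lt0n multiplicity_gt0.
rewrite (_ : _ `&` _ = set0) ?measure0 ?mule0//.
by apply/seteqP; split => // z [yA' _]; apply: yA; rewrite inE.
Qed.

(* Disintegrate Pi along the atoms of the empirical law of x and send the share
   1 / multiplicity of each fiber, attached to the index j, to the new atom y j. *)
Lemma coupling_glue : exists2 Pi', couplings mu (empirical y N) Pi' &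
  (\int[Pi']_z (l1norm (z.1 - z.2))%:E <=
   \int[Pi]_z (l1norm (z.1 - z.2))%:E +
   (N%:R^-1 * \sum_(j < N) l1norm (x j - y j))%:E)%E.
Proof.
have gluedT : glued setT = 1%E.
  rewrite -(preimage_setT fst) glued_fst//.
  by have [<- _] := PiP measurableT; rewrite preimage_setT probability_setT.
pose Pi' : probability (Rn * Rn)%type R :=
  HB.pack (msum piece N) (Measure_isProbability.Build _ _ _ (msum piece N) gluedT).
exists Pi'; first by move=> A mA; split; [exact: glued_fst|exact: glued_snd].
have ml (f g : Rn * Rn -> Rn) : measurable_fun setT f -> measurable_fun setT g ->
    measurable_fun setT (fun z => (l1norm (f z - g z))%:E).
  by move=> mf mg; apply/measurable_EFinP; exact: measurable_l1norm.
have l0 (v : Rn) : (0 <= (l1norm v)%:E)%E by rewrite lee_fin sumr_ge0.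
rewrite glued_ge0_integral//; last by apply: ml.
rewrite integral_fibers//; last by apply: ml.
rewrite mulr_sumr -sumEFin -big_split /=.
apply: lee_sum => j _.
have cj0 : (0 <= (c j)%:E)%E by rewrite lee_fin.
(* Spread the cost of moving [x j] to [y j] over the fiber, where the triangle inequality applies
   pointwise. *)
have -> : (N%:R^-1 * l1norm (x j - y j))%:E =
    ((c j)%:E * \int[Pi]_(z in fiber j) (l1norm (x j - y j))%:E)%E.
  rewrite integral_cst// -[RHS]/((c j)%:E *
    ((l1norm (x j - y j))%:E * Pi (fiber j)))%E Pi_fiber -!EFinM; congr EFin.
  rewrite /c; field; rewrite !pnatr_eq0 -!lt0n N0.
  by rewrite multiplicity_gt0.
rewrite -muleDr//; last by rewrite ge0_adde_def// inE integral_ge0.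
rewrite lee_pmul//; first by apply: integral_ge0.
rewrite -ge0_integralD//; last first.
  by apply: measurable_funTS; apply: ml.
apply: ge0_le_integral => //.
- by apply: measurable_funTS; apply: ml.
- by apply: emeasurable_funD => //; apply: measurable_funTS; apply: ml.
move=> z zj; rewrite -EFinD lee_fin.
have <- : z.2 - y j = x j - y j by rewrite zj.
rewrite /l1norm -big_split /=; apply: ler_sum => i _.
rewrite !mxE (_ : z.1 0 i - y j 0 i = (z.1 0 i - z.2 0 i) + (z.2 0 i - y j 0 i)).
  exact: ler_normD.
by ring.
Qed.

End gluing.

Section wasserstein_empirical.
Context (R : realType) (n : nat).
Local Notation Rn := 'rV[R]_n.
Implicit Types (mu : set Rn -> \bar R) (N : nat).

(** Every coupling for [x] yields one for [y] at this extra cost; if there is none, both distances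
    are infinite. *)
Lemma wasserstein_empirical_le mu N (x y : nat -> Rn) : (0 < N)%N ->
  (wasserstein mu (empirical y N) <= wasserstein mu (empirical x N) +
     (N%:R^-1 * \sum_(j < N) l1norm (x j - y j))%:E)%E.
Proof.
move=> N0; rewrite -leeBlDr//; apply: le_ereal_inf_tmp => _ [Pi PiP <-].
rewrite leeBlDr//; have [Pi' Pi'P] := coupling_glue y N0 PiP.
by apply: le_trans; apply: ereal_inf_lbound; exists Pi'.
Qed.

Lemma eq_empirical d (T : measurableType d) (x y : nat -> T) N :
  (forall j, (j < N)%N -> x j = y j) ->
  empirical x N = empirical y N :> (set T -> \bar R).
Proof.
move=> xy; apply/funext => A; rewrite /empirical; congr (_ * _)%E.
by apply: eq_bigr => j _; rewrite xy.
Qed.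

(* A measure is a function on all sets, so the bound defining the radius has a
   content only for measurable events. *)
Lemma measurable_wasserstein_empirical d (T : measurableType d)
    (X : nat -> T -> Rn) mu N (e : R) : (0 < N)%N ->
  (forall j, measurable_fun setT (X j)) ->
  measurable [set t | (wasserstein mu (empirical (X ^~ t) N) <= e%:E)%E].
Proof.
move=> N0 mX.
(* The [N] samples become one row vector, so that openness in a single space gives measurability.
   The value 0 of [unflat] from index [N] on is never read by [empirical]. *)
pose flat t : 'rV[R]_(N * n) := mxvec (\matrix_(j < N, i < n) X j t 0 i).
pose unflat (v : 'rV[R]_(N * n)) (j : nat) : Rn :=
  if insub j is Some j' then row j' (vec_mx v) else 0.
have flatK t j : (j < N)%N -> unflat (flat t) j = X j t.
  move=> jN; rewrite /unflat /flat insubT mxvecK.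
  by apply/rowP => i; rewrite !mxE.
pose A := [set v | (e%:E < wasserstein mu (empirical (unflat v) N))%E].
have oA : open A.
  rewrite openE => v; rewrite /A /= => ev.
  have [r r0 er] : exists2 r : R, 0 < r &
      (e%:E + r%:E < wasserstein mu (empirical (unflat v) N))%E.
    move: ev; case: (wasserstein _ _) => [w|_|//].
      rewrite lte_fin => ew; exists ((w - e) / 2).
        by rewrite divr_gt0// subr_gt0.
      by rewrite -EFinD lte_fin; lra.
    by exists 1 => //; rewrite -EFinD ltry.
  (* The [n] coordinates of a block each move by less than [r / n.+1%:R], hence by at most [r] in
     l1-norm; the successor covers [n = 0]. *)
  have n0 : 0 < n.+1%:R :> R by [].
  apply/nbhs_ballP; exists (r / n.+1%:R) => [|u vu]; first exact: divr_gt0.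
  rewrite /A /= -(@lteD2rE _ r%:E)//; apply: (lt_le_trans er).
  apply: (le_trans (wasserstein_empirical_le mu (unflat u) (unflat v) N0)).
  rewrite leeD2l// lee_fin.
  apply: le_trans (_ : N%:R^-1 * \sum_(j < N) r <= _); last first.
    by rewrite sumr_const card_ord -[r *+ N]mulr_natl mulKf// pnatr_eq0 -lt0n.
  rewrite ler_wpM2l ?invr_ge0//; apply: ler_sum => j _.
  rewrite /unflat insubT//= => jN; rewrite /l1norm.
  apply: le_trans (_ : \sum_(i < n) r / n.+1%:R <= _).
    by apply: ler_sum => i _; rewrite !mxE distrC; apply/ltW; exact: vu.2.
  rewrite sumr_const card_ord -[_ *+ n]mulr_natr -mulrA ler_piMr//; first exact: ltW.
  by rewrite mulrC ler_pdivrMr// mul1r ler_nat.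
have mflat : measurable_fun setT flat.
  apply: measurable_rV => k; case/mxvec_indexP: k => j i.
  under eq_fun do rewrite /flat mxvecE mxE.
  exact: measurable_coordT.
rewrite (_ : [set t | _] = flat @^-1` (~` A)).
  rewrite -[X in measurable X]setTI; apply: mflat => //.
  by apply: closed_measurable_rV; exact: open_closedC.
apply/seteqP; split => t; rewrite /A /=.
all: rewrite (eq_empirical (flatK t)) leNgt; by move/negP.
Qed.

End wasserstein_empirical.

(** * Integrals of bounded functions *)

Section bounded_measurable.
Context d (T : measurableType d) (R : realType).
Implicit Types (f g : T -> R) (P : probability T R).

(** A class stable under the algebra of polynomial expressions and integrable for every probability,
    which settles all integrability conditions below. *)
Definition bounded_measurable f :=
  measurable_fun setT f /\ exists K, forall x, `|f x| <= K.

Lemma bounded_measurable_cst r : bounded_measurable (fun=> r).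
Proof. by split => //; exists `|r|. Qed.

Lemma bounded_measurableD f g : bounded_measurable f -> bounded_measurable g ->
  bounded_measurable (fun x => f x + g x).
Proof.
move=> [mf [K fK]] [mg [L gL]]; split; first exact: measurable_funD.
by exists (K + L) => x; rewrite (le_trans (ler_normD _ _))// lerD.
Qed.

Lemma bounded_measurableM f g : bounded_measurable f -> bounded_measurable g ->
  bounded_measurable (fun x => f x * g x).
Proof.
move=> [mf [K fK]] [mg [L gL]]; split; first exact: measurable_funM.
by exists (K * L) => x; rewrite normrM ler_pM.
Qed.

Lemma bounded_measurableB f g : bounded_measurable f -> bounded_measurable g ->
  bounded_measurable (fun x => f x - g x).
Proof.
move=> bf bg; under eq_fun do rewrite -mulN1r.
by apply: bounded_measurableD => //; apply: bounded_measurableM => //;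
  exact: bounded_measurable_cst.
Qed.

Lemma bounded_measurableX f k : bounded_measurable f ->
  bounded_measurable (fun x => f x ^+ k).
Proof.
move=> bf; elim: k => [|k IH]; first exact: bounded_measurable_cst.
by under eq_fun do rewrite exprS; exact: bounded_measurableM.
Qed.

Lemma bounded_measurable_sum I (s : seq I) (h : I -> T -> R) :
  (forall i, bounded_measurable (h i)) ->
  bounded_measurable (fun x => \sum_(i <- s) h i x).
Proof.
move=> bh; elim: s => [|i s IH].
  by under eq_fun do rewrite big_nil; exact: bounded_measurable_cst.
by under eq_fun do rewrite big_cons; exact: bounded_measurableD.
Qed.

Lemma bounded_measurable_integrable P f : bounded_measurable f ->
  P.-integrable setT (EFin \o f).
Proof.
move=> [mf [K fK]]; apply: measurable_bounded_integrable => //.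
  by rewrite (le_lt_trans (probability_le1 _ _))// ltry.
exists K; split => [|M KM x _]; first exact: num_real.
exact: (le_trans (fK x) (ltW KM)).
Qed.

Lemma bounded_RintegralE P f : bounded_measurable f ->
  (\int[P]_x (f x)%:E)%E = (\int[P]_x f x)%:E.
Proof.
move=> bf; rewrite /Rintegral fineK//.
exact/integrable_fin_num/bounded_measurable_integrable.
Qed.

Lemma bounded_RintegralD P f g : bounded_measurable f -> bounded_measurable g ->
  \int[P]_x (f x + g x) = \int[P]_x f x + \int[P]_x g x.
Proof.
by move=> bf bg; apply: RintegralD => //; exact: bounded_measurable_integrable.
Qed.

Lemma bounded_RintegralB P f g : bounded_measurable f -> bounded_measurable g ->
  \int[P]_x (f x - g x) = \int[P]_x f x - \int[P]_x g x.
Proof.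
by move=> bf bg; apply: RintegralB => //; exact: bounded_measurable_integrable.
Qed.

Lemma bounded_RintegralZ P r f : bounded_measurable f ->
  \int[P]_x (r * f x) = r * \int[P]_x f x.
Proof.
by move=> bf; apply: RintegralZl => //; exact: bounded_measurable_integrable.
Qed.

Lemma bounded_Rintegral_sum P I (s : seq I) (h : I -> T -> R) :
  (forall i, bounded_measurable (h i)) ->
  \int[P]_x (\sum_(i <- s) h i x) = \sum_(i <- s) \int[P]_x h i x.
Proof.
move=> bh; elim: s => [|i s IH].
  under eq_Rintegral do rewrite big_nil.
  by rewrite big_nil Rintegral_cst// mul0r.
under eq_Rintegral do rewrite big_cons.
rewrite big_cons -IH bounded_RintegralD//.
exact: bounded_measurable_sum.
Qed.

Lemma Rintegral_probability_cst P r : \int[P]_x r = r.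
Proof.
rewrite Rintegral_cst// [X in fine X](_ : _ = 1%E) ?mulr1//.
exact: probability_setT.
Qed.

Lemma eq_Rintegral_prob1 P (A : set T) f g : measurable A -> P A = 1%E ->
  bounded_measurable f -> bounded_measurable g ->
  (forall x, A x -> f x = g x) -> \int[P]_x f x = \int[P]_x g x.
Proof.
move=> mA PA [mf _] [mg _] fg; rewrite /Rintegral; congr fine.
apply: ae_eq_integral => //; [exact/measurable_EFinP|exact/measurable_EFinP|].
exists (~` A); split; [exact: measurableC|exact: probability1_setC|].
by move=> x /= fgx Ax; apply: fgx => _; rewrite fg.
Qed.

Lemma norm_Rintegral_le P (A : set T) f K : measurable A -> P A = 1%E ->
  bounded_measurable f -> 0 <= K -> (forall x, A x -> `|f x| <= K) ->
  `|\int[P]_x f x| <= K.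
Proof.
move=> mA PA bf K0 fK.
(* Outside [A] the bound [K] may fail; the indicator restores it everywhere without changing the
   integral. *)
have bg : bounded_measurable (fun x => f x * \1_A x).
  apply: bounded_measurableM => //; split; first exact: measurable_indic.
  by exists 1 => x; rewrite indicE; case: (_ \in _); rewrite ?normr1 ?normr0.
rewrite (@eq_Rintegral_prob1 _ A f (fun x => f x * \1_A x))//; last first.
  by move=> x Ax; rewrite indicE mem_set// mulr1.
apply: (le_trans (le_normr_Rintegral _ _)) => //.
  exact: bounded_measurable_integrable.
rewrite -[leRHS](Rintegral_probability_cst P); apply: le_Rintegral => //.
- apply: (@bounded_measurable_integrable P (fun x => `|f x * \1_A x|)).
  case: bg => mg [L gL]; split; first exact: measurableT_comp.
  by exists L => x; rewrite normr_id.
- exact: (bounded_measurable_integrable P (bounded_measurable_cst K)).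
move=> x _; rewrite indicE; case: (boolP (x \in A)) => [|_].
  by rewrite inE mulr1 => /fK.
by rewrite mulr0 normr0.
Qed.

End bounded_measurable.

Lemma bounded_measurable_comp d d' (T : measurableType d) (T' : measurableType d')
    (R : realType) (f : T' -> R) (g : T -> T') :
  bounded_measurable f -> measurable_fun setT g ->
  bounded_measurable (fun x => f (g x)).
Proof.
move=> [mf [K fK]] mg; split; first exact: (measurableT_comp mf mg).
by exists K.
Qed.

Lemma Rintegral_product d d' (T : measurableType d) (T' : measurableType d')
    (R : realType) (P : probability T R) (P' : probability T' R)
    (f : T -> R) (g : T' -> R) :
  bounded_measurable f -> bounded_measurable g ->
  \int[(P \x P')%E]_z (f z.1 * g z.2) = (\int[P]_x f x) * (\int[P']_x g x).
Proof.
move=> bf bg.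
have bfg : bounded_measurable (fun z : T * T' => f z.1 * g z.2).
  apply: bounded_measurableM.
    by apply: bounded_measurable_comp => //; exact: measurable_fst.
  by apply: bounded_measurable_comp => //; exact: measurable_snd.
have ifg := bounded_measurable_integrable (P \x P')%E bfg.
rewrite {1}/Rintegral -(integral12_prod_meas1 ifg) /fubini_F /=.
rewrite mulrC -bounded_RintegralZ//; congr fine; apply: eq_integral => x _.
rewrite -[LHS]/(\int[P']_y (f x * g y)%:E)%E bounded_RintegralE; last first.
  by apply: bounded_measurableM => //; exact: bounded_measurable_cst.
by rewrite bounded_RintegralZ// mulrC.
Qed.

Section coupling.
Context (R : realType) (n : nat).
Local Notation Rn := 'rV[R]_n.
Implicit Types (g : Rn -> R).

(** Two probability spaces are allowed: marginals of a coupling are compared both with the sum of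
    signal and noise on a product space and with marginals of another coupling. *)
Lemma Rintegral_law d (T : measurableType d) (P : probability T R)
    d' (T' : measurableType d') (P' : probability T' R)
    (X : T -> Rn) (X' : T' -> Rn) g :
  measurable_fun setT X -> measurable_fun setT X' ->
  (forall A, measurable A -> P (X @^-1` A) = P' (X' @^-1` A)) ->
  bounded_measurable g -> \int[P]_t g (X t) = \int[P']_t g (X' t).
Proof.
move=> mX mX' XX' bg; rewrite /Rintegral; congr fine.
have mg : measurable_fun setT (EFin \o g) by apply/measurable_EFinP; case: bg.
rewrite -[LHS]/(\int[P]_(t in X @^-1` setT) ((EFin \o g) \o X) t)%E.
rewrite -integral_pushforward//; last first.
  rewrite preimage_setT.
  exact: (bounded_measurable_integrable P (bounded_measurable_comp bg mX)).
rewrite -[RHS]/(\int[P']_(t in X' @^-1` setT) ((EFin \o g) \o X') t)%E.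
rewrite -integral_pushforward//; last first.
  rewrite preimage_setT.
  exact: (bounded_measurable_integrable P' (bounded_measurable_comp bg mX')).
by apply: eq_measure_integral => A mA _; exact: XX'.
Qed.

(** The easy half of Kantorovich duality. The strict bound is what an infimum over couplings
    provides, so no optimal coupling has to exist. *)
Lemma coupling_lipschitz (Pi : probability (Rn * Rn)%type R) g C e :
  bounded_measurable g -> 0 <= C ->
  (forall x y, `|g x - g y| <= C * l1norm (x - y)) ->
  (\int[Pi]_z (l1norm (z.1 - z.2))%:E < e%:E)%E ->
  `|\int[Pi]_z g z.1 - \int[Pi]_z g z.2| <= C * e.
Proof.
move=> bg C0 gC le.
have bg1 : bounded_measurable (fun z : Rn * Rn => g z.1).
  exact: bounded_measurable_comp.
have bg2 : bounded_measurable (fun z : Rn * Rn => g z.2).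
  exact: bounded_measurable_comp.
rewrite -bounded_RintegralB// -lee_fin.
have bgB := bounded_measurable_integrable Pi (bounded_measurableB bg1 bg2).
rewrite EFin_normr_Rintegral//.
have mB : measurable_fun setT (fun z : Rn * Rn => (g z.1 - g z.2)%:E).
  exact: measurable_int bgB.
have ml : measurable_fun setT (fun z : Rn * Rn => (l1norm (z.1 - z.2))%:E).
  by apply/measurable_EFinP; apply: measurable_l1norm.
have l0 (v : Rn) : (0 <= (l1norm v)%:E)%E by rewrite lee_fin sumr_ge0.
apply: (le_trans (le_abse_integral _ _ mB)) => //.
apply: (@le_trans _ _ (\int[Pi]_z (C%:E * (l1norm (z.1 - z.2))%:E))%E).
  apply: ge0_le_integral => //; first exact: measurableT_comp.
    exact: measurable_funeM.
  by move=> z _; rewrite lee_fin.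
by rewrite ge0_integralZl_EFin// EFinM lee_wpmul2l ?lee_fin// ltW.
Qed.

End coupling.

(** * Noisy laws and their moments *)

Section clip.
Context {R : realType}.
Implicit Types (K t s : R).

Definition clip K t : R := Num.max (- K) (Num.min K t).

Lemma clip_id K t : `|t| <= K -> clip K t = t.
Proof.
rewrite ler_norml => /andP[Kt tK]; rewrite /clip.
by rewrite (min_idPr tK) (max_idPr Kt).
Qed.

Lemma clip_le K t : 0 <= K -> `|clip K t| <= K.
Proof.
move=> K0; rewrite ler_norml /clip le_max lexx/= ge_max ge_min lexx/= andbT.
lra.
Qed.

Lemma clip_lipschitz K t s : `|clip K t - clip K s| <= `|t - s|.
Proof.
wlog ts : t s / t <= s => [H|].
  by have [/H//|/ltW /H] := leP t s; rewrite distrC [leRHS]distrC.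
rewrite [leRHS]distrC [leRHS]ger0_norm ?subr_ge0// ler_norml /clip /Num.max /Num.min.
by case: (ltP K t) => tK; case: (ltP K s) => sK; case: ltP => ?;
  case: ltP => ?; apply/andP; split; lra.
Qed.

Lemma bounded_measurable_clip d (T : measurableType d) K (f : T -> R) :
  0 <= K -> measurable_fun setT f -> bounded_measurable (fun x => clip K (f x)).
Proof.
move=> K0 mf; split; last by exists K => x; exact: clip_le.
apply: (measurable_maxr (f := fun=> - K)) => //.
exact: (measurable_minr (f := fun=> K)).
Qed.

Lemma exprn_lipschitz K k : exists2 C, 0 <= C & forall t s : R,
  `|t| <= K -> `|s| <= K -> `|t ^+ k - s ^+ k| <= C * `|t - s|.
Proof.
elim: k => [|k [C C0 IH]].
  by exists 0 => // t s _ _; rewrite !expr0 subrr normr0 mul0r.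
exists (`|K| ^+ k + C * `|K|) => [|t s tK sK].
  by rewrite addr_ge0 ?mulr_ge0.
have -> : t ^+ k.+1 - s ^+ k.+1 = t ^+ k * (t - s) + (t ^+ k - s ^+ k) * s.
  by rewrite !exprS; ring.
rewrite (le_trans (ler_normD _ _))// !normrM mulrDl lerD//.
  rewrite ler_wpM2r// normrX lerXn2r ?nnegrE//.
  by rewrite (le_trans tK)// ler_norm.
rewrite mulrAC ler_pM// ?IH//.
by rewrite (le_trans sK)// ler_norm.
Qed.

End clip.

Section noise_op.
Context (R : realType) (n : nat) (FE : probability 'rV[R]_n R).
Local Notation Rn := 'rV[R]_n.
Variable S : set Rn.
Hypothesis mS : measurable S.
Implicit Types (Q : probability Rn R) (nu : set Rn -> \bar R) (g : Rn -> R).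

Let mconv : measurable_fun setT (fun p : Rn * Rn => p.2 + p.1).
Proof. by apply: measurable_addrV. Qed.

(** The noisy law is that of a sum of independent variables: the section at [x] of the preimage of
    [A] is the set measured by [noise_kernel], and [Q] does not charge the complement of [S]. *)
Lemma noise_opE Q A : Q S = 1%E -> measurable A ->
  noise_op FE S Q A = (Q \x FE)%E ((fun p => p.2 + p.1) @^-1` A).
Proof.
move=> QS mA; rewrite /noise_op.
have mA' : measurable ((fun p : Rn * Rn => p.2 + p.1) @^-1` A).
  by rewrite -[X in measurable X]setTI; exact: mconv.
rewrite /product_measure1 (@ge0_negligible_integral _ _ _ _ setT (~` S))//.
- rewrite setTD setCK; apply: eq_integral => x _; rewrite /noise_kernel /=.
  by congr (FE _); apply/seteqP; split => z; rewrite /xsection /= inE.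
- exact: measurableC.
- exact: (measurable_fun_xsection FE mA').
- exact: probability1_setC.
Qed.

Lemma coupling_noise Q nu Pi g : Q S = 1%E ->
  couplings (noise_op FE S Q) nu Pi -> bounded_measurable g ->
  \int[Pi]_z g z.1 = \int[(Q \x FE)%E]_p g (p.2 + p.1).
Proof.
move=> QS PiP bg; apply: (Rintegral_law (X := fst)) => // A mA.
by have [-> _] := PiP A mA; rewrite noise_opE.
Qed.

(* Both noisy laws are compared with nu, so no triangle inequality for the
   Wasserstein distance is needed. *)
Lemma noise_lipschitz Q Q' nu g C e : Q S = 1%E -> Q' S = 1%E ->
  (wasserstein (noise_op FE S Q) nu < e%:E)%E ->
  (wasserstein (noise_op FE S Q') nu < e%:E)%E ->
  bounded_measurable g -> 0 <= C ->
  (forall x y, `|g x - g y| <= C * l1norm (x - y)) ->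
  `|\int[(Q \x FE)%E]_p g (p.2 + p.1) - \int[(Q' \x FE)%E]_p g (p.2 + p.1)| <=
  C * e + C * e.
Proof.
move=> QS QS' /ereal_inf_lt[_ [Pi PiP <-] lePi].
move=> /ereal_inf_lt[_ [Pi' PiP' <-] lePi'] bg C0 gC.
rewrite -(coupling_noise QS PiP bg) -(coupling_noise QS' PiP' bg).
have snd_eq : \int[Pi]_z g z.2 = \int[Pi']_z g z.2.
  apply: (Rintegral_law (X := snd) (X' := snd)) => // A mA.
  by have [_ ->] := PiP A mA; have [_ ->] := PiP' A mA.
have := coupling_lipschitz bg C0 gC lePi.
have := coupling_lipschitz bg C0 gC lePi'.
rewrite snd_eq distrC => h1 h2.
rewrite -(subrK (\int[Pi']_z g z.2) (\int[Pi]_z g z.1)) -addrA.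
by rewrite (le_trans (ler_normD _ _))// lerD.
Qed.

End noise_op.

(** * Recovering latent moments and utilities from noisy laws *)

Section moments.
Context (R : realType) (n : nat) (FE : probability 'rV[R]_n R).
Local Notation Rn := 'rV[R]_n.
Variables (S Z W : set Rn) (M C : R).
Hypotheses (mS : measurable S) (mZ : measurable Z) (FEZ : FE Z = 1%E).
Hypotheses (M0 : 0 < M) (C0 : 0 <= C).
Hypothesis SM : forall w x, W w -> S x -> `|dotp w x| <= M.
Hypothesis ZM : forall w z, W w -> Z z -> `|dotp w z| <= M.
Hypothesis WC : forall w i, W w -> `|w 0 i| <= C.
Implicit Types (P Q : probability Rn R) (nu : set Rn -> \bar R).

Lemma dotpD (w x y : Rn) : dotp w (x + y) = dotp w x + dotp w y.
Proof.
by rewrite /dotp -big_split; apply: eq_bigr => i _; rewrite mxE mulrDr.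
Qed.

Lemma dotpBl (w w' x : Rn) : dotp w x - dotp w' x = dotp (w - w') x.
Proof.
by rewrite /dotp -sumrB; apply: eq_bigr => i _; rewrite !mxE mulrBl.
Qed.

Lemma norm_dotp_le (w x : Rn) (K : R) : (forall i, `|w 0 i| <= K) ->
  `|dotp w x| <= K * l1norm x.
Proof.
move=> wK; rewrite (le_trans (ler_norm_sum _ _ _))// mulr_sumr.
by apply: ler_sum => i _; rewrite normrM ler_wpM2r.
Qed.

Let bclip K w : 0 <= K -> bounded_measurable (fun x : Rn => clip K (dotp w x)).
Proof. by move=> K0; apply: bounded_measurable_clip => //; exact: measurable_dotp. Qed.

(* For P carried by S or Z the clipping is invisible; it makes the integrands
   bounded, and their powers Lipschitz, on the whole space. *)
Definition moment P (w : Rn) (k : nat) : R := \int[P]_x (clip M (dotp w x) ^+ k).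

Let bmoment w k : bounded_measurable (fun x : Rn => clip M (dotp w x) ^+ k).
Proof. by apply/bounded_measurableX/bclip/ltW. Qed.

Lemma moment_le P w k : `|moment P w k| <= M ^+ k.
Proof.
apply: (@norm_Rintegral_le _ _ _ P setT) => //.
- exact: probability_setT.
- by rewrite exprn_ge0// ltW.
by move=> x _; rewrite normrX lerXn2r ?nnegrE ?clip_le// ltW.
Qed.

(** Binomial expansion and independence. On [S] times [Z], of full measure, no clipping acts; the
    level [M + M] leaves room for the sum. *)
Lemma moment_noise Q w k : Q S = 1%E -> W w ->
  \int[(Q \x FE)%E]_p (clip (M + M) (dotp w (p.2 + p.1)) ^+ k) =
  \sum_(i < k.+1) 'C(k, i)%:R * (moment Q w (k - i) * moment FE w i).
Proof.
move=> QS Ww.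
have MM0 : 0 <= M + M by rewrite addr_ge0// ltW.
pose h i (p : Rn * Rn) : R :=
  'C(k, i)%:R * (clip M (dotp w p.1) ^+ (k - i) * clip M (dotp w p.2) ^+ i).
have bh' i : bounded_measurable (fun p : Rn * Rn =>
    clip M (dotp w p.1) ^+ (k - i) * clip M (dotp w p.2) ^+ i).
  apply: bounded_measurableM.
    by apply: (bounded_measurable_comp (bmoment w (k - i))).
  by apply: (bounded_measurable_comp (bmoment w i)).
have bh i : bounded_measurable (h i).
  by apply: bounded_measurableM => //; exact: bounded_measurable_cst.
rewrite (@eq_Rintegral_prob1 _ _ _ (Q \x FE)%E (S `*` Z) _
  (fun p => \sum_(i < k.+1) h i p)).
- rewrite bounded_Rintegral_sum//; apply: eq_bigr => i _.
  rewrite /h bounded_RintegralZ//; congr (_ * _).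
  exact: (Rintegral_product Q FE (bmoment w (k - i)) (bmoment w i)).
- exact: measurableX.
- by rewrite -[LHS]/((Q \x FE)%E (S `*` Z)) product_measure1E//
    -[LHS]/(Q S * FE Z)%E QS FEZ mule1.
- apply: (bounded_measurable_comp (bounded_measurableX k (bclip w MM0))).
  exact: measurable_addrV.
- exact: bounded_measurable_sum.
move=> [x z] [/= /(SM Ww) xM /(ZM Ww) zM].
rewrite /= [z + x]addrC dotpD clip_id; last by rewrite (le_trans (ler_normD _ _))// lerD.
by rewrite exprDn; apply: eq_bigr => i _; rewrite /h /= !clip_id// mulr_natl.
Qed.

(* The term i = 0 of [moment_noise] is the moment k of Q itself, the others involve
   moments of Q of lower order: the moments of Q are recovered from the noisy ones. *)
Lemma moments_close k (e : R) : 0 < e -> exists2 eta : R, 0 < eta &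
  forall Q Q' nu w, Q S = 1%E -> Q' S = 1%E -> W w ->
    (wasserstein (noise_op FE S Q) nu < eta%:E)%E ->
    (wasserstein (noise_op FE S Q') nu < eta%:E)%E ->
    forall j, (j < k)%N -> `|moment Q w j - moment Q' w j| <= e.
Proof.
elim: k e => [|k IH] e e0; first by exists 1.
(* [B] bounds the total weight of the lower-order moments, so an error [e'] on each costs at most
   [e / 2]. Adding 1 to a denominator avoids division by 0, here and below. *)
pose B := \sum_(i < k) 'C(k, i.+1)%:R * M ^+ i.+1.
have B0 : 0 <= B by rewrite sumr_ge0// => i _; rewrite mulr_ge0// exprn_ge0// ltW.
have B10 : 0 < B + 1 by rewrite ltr_wpDl.
pose e' := Num.min e (e / 2 / (B + 1)).
have e'0 : 0 < e' by rewrite lt_min e0 !divr_gt0.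
have [eta eta0 Heta] := IH _ e'0.
have [D D0 HD] := exprn_lipschitz (M + M) k.
have MM0 : 0 <= M + M by rewrite addr_ge0// ltW.
have DC0 : 0 <= D * C by rewrite mulr_ge0.
have DC10 : 0 < D * C + 1 by rewrite ltr_wpDl.
(* [D * C] is the Lipschitz constant of the clipped power; each of the two couplings then costs at
   most [e / 4]. *)
exists (Num.min eta (e / 4 / (D * C + 1))).
  by rewrite lt_min eta0 !divr_gt0.
move=> Q Q' nu w QS Q'S Ww wQ wQ'.
have H1 := Heta Q Q' nu w QS Q'S Ww
  (lt_le_trans wQ _) (lt_le_trans wQ' _).
have {}H1 : forall j, (j < k)%N -> `|moment Q w j - moment Q' w j| <= e'.
  by apply: H1; rewrite lee_fin ge_min lexx.
move=> j; rewrite ltnS leq_eqVlt => /predU1P[->{j}|jk]; last first.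
  by rewrite (le_trans (H1 j jk))// ge_min lexx.
have wQ2 : (wasserstein (noise_op FE S Q) nu < (e / 4 / (D * C + 1))%:E)%E.
  by rewrite (lt_le_trans wQ)// lee_fin ge_min lexx orbT.
have wQ2' : (wasserstein (noise_op FE S Q') nu < (e / 4 / (D * C + 1))%:E)%E.
  by rewrite (lt_le_trans wQ')// lee_fin ge_min lexx orbT.
have bg := bounded_measurableX k (bclip w MM0).
have gL (x y : Rn) : `|clip (M + M) (dotp w x) ^+ k -
    clip (M + M) (dotp w y) ^+ k| <= D * C * l1norm (x - y).
  rewrite (le_trans (HD _ _ _ _))// ?clip_le// -mulrA ler_wpM2l//.
  rewrite (le_trans (clip_lipschitz _ _ _))//.
  have -> : dotp w x - dotp w y = dotp w (x - y).
    by apply/eqP; rewrite subr_eq -dotpD subrK.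
  by apply: norm_dotp_le => i; exact: WC.
have := noise_lipschitz mS QS Q'S wQ2 wQ2' bg DC0 gL.
rewrite !moment_noise// -sumrB big_ord_recl /= !subn0 bin0 !mul1r.
have m0 : moment FE w 0 = 1.
  rewrite /moment; under eq_Rintegral do rewrite expr0.
  exact: Rintegral_probability_cst.
rewrite m0 !mulr1.
set s := \sum_(i < k) _.
have sle : `|s| <= e / 2.
  apply: (@le_trans _ _ (e' * B)).
    rewrite mulr_sumr (le_trans (ler_norm_sum _ _ _))//; apply: ler_sum => i _.
    rewrite /bump /= add1n -mulrBr -mulrBl !normrM ger0_norm// [leRHS]mulrCA.
    rewrite ler_wpM2l// ler_pM//; last exact: moment_le.
    by apply: H1; rewrite ltn_subrL (leq_ltn_trans _ (ltn_ord i)).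
  apply: (@le_trans _ _ (e / 2 / (B + 1) * B)).
    by rewrite ler_wpM2r// ge_min lexx orbT.
  rewrite -mulrA ler_piMr ?divr_ge0 ?(ltW e0)// mulrC ler_pdivrMr// mul1r.
  by rewrite lerDl.
set x := moment Q w k - moment Q' w k => H.
have DCe : D * C * (e / 4 / (D * C + 1)) <= e / 4.
  rewrite [leLHS]mulrCA.
  rewrite ler_piMr ?divr_ge0 ?(ltW e0)// ler_pdivrMr// mul1r.
  by rewrite lerDl.
rewrite -[x](addrK s) (le_trans (ler_normB _ _))//.
by move: H; rewrite /= -/s; lra.
Qed.

Section utility.
Variable U : R -> R.
Hypothesis cU : continuous U.

Definition clipped_utility P (w : Rn) : R := \int[P]_x U (clip M (dotp w x)).

Let butility w : bounded_measurable (fun x : Rn => U (clip M (dotp w x))).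
Proof.
have M0' := ltW M0.
split.
  apply: (measurableT_comp (continuous_measurable_fun cU)).
  by case: (bclip w M0').
have [K _ UK] := continuous_segment_bounded (- M) M cU.
by exists K => x; apply: UK; rewrite -ler_norml clip_le.
Qed.

Lemma clipped_utility_bounded :
  exists K : R, forall P w, `|clipped_utility P w| <= K.
Proof.
have [K K0 UK] := continuous_segment_bounded (- M) M cU.
exists K => P w; apply: (@norm_Rintegral_le _ _ _ P setT) => //.
- exact: probability_setT.
- exact: ltW.
by move=> x _; apply: UK; rewrite -ler_norml clip_le// ltW.
Qed.

Lemma expected_utilityE Q w : Q S = 1%E -> W w ->
  expected_utility U Q w = (clipped_utility Q w)%:E.
Proof.
move=> QS Ww; rewrite /expected_utility unlock -bounded_RintegralE//.
apply: ae_eq_integral => //.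
- apply/measurable_EFinP/(measurableT_comp (continuous_measurable_fun cU)).
  exact: measurable_dotp.
- by apply/measurable_EFinP; case: (butility w).
exists (~` S); split; [exact: measurableC|exact: probability1_setC|].
by move=> x /= + Sx; apply => _; rewrite clip_id// SM.
Qed.

Lemma clipped_utility_close (e : R) : 0 < e -> exists2 eta : R, 0 < eta &
  forall Q Q' nu w, Q S = 1%E -> Q' S = 1%E -> W w ->
    (wasserstein (noise_op FE S Q) nu < eta%:E)%E ->
    (wasserstein (noise_op FE S Q') nu < eta%:E)%E ->
    `|clipped_utility Q w - clipped_utility Q' w| <= e.
Proof.
move=> e0; have e40 : 0 < e / 4 by rewrite divr_gt0.
(* Budget: [e / 4] for replacing [U] by [p] under each law, and [e / 2] for the finitely many
   moments that [p] involves. *)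
have [p pU] := weierstrass_segment cU M0 e40.
pose A := \sum_(i < size p) `|p`_i|.
have A0 : 0 <= A by rewrite sumr_ge0.
have A10 : 0 < A + 1 by rewrite ltr_wpDl.
have [|eta eta0 Heta] := @moments_close (size p) (e / 2 / (A + 1)).
  by rewrite !divr_gt0.
exists eta => // Q Q' nu w QS Q'S Ww wQ wQ'.
have bp : bounded_measurable (fun x : Rn => p.[clip M (dotp w x)]).
  under eq_fun do rewrite horner_coef.
  apply: bounded_measurable_sum => i; apply: bounded_measurableM => //.
  exact: bounded_measurable_cst.
have Up (P : probability Rn R) :
    `|clipped_utility P w - \int[P]_x p.[clip M (dotp w x)]| <= e / 4.
  rewrite /clipped_utility -bounded_RintegralB//.
  apply: (@norm_Rintegral_le _ _ _ P setT) => //; last 2 first.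
  - exact: ltW.
  - by move=> x _; apply/pU/clip_le/ltW.
  - exact: probability_setT.
  - exact: bounded_measurableB.
have pE (P : probability Rn R) : \int[P]_x p.[clip M (dotp w x)] =
    \sum_(i < size p) p`_i * moment P w i.
  under eq_Rintegral do rewrite horner_coef.
  rewrite bounded_Rintegral_sum; last first.
    move=> i; apply: bounded_measurableM => //; exact: bounded_measurable_cst.
  by apply: eq_bigr => i _; rewrite bounded_RintegralZ.
have pp : `|\int[Q]_x p.[clip M (dotp w x)] -
    \int[Q']_x p.[clip M (dotp w x)]| <= e / 2.
  rewrite !pE -sumrB (le_trans (ler_norm_sum _ _ _))//.
  apply: (@le_trans _ _ (A * (e / 2 / (A + 1)))).
    rewrite mulr_suml; apply: ler_sum => i _; rewrite -mulrBr normrM.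
    by rewrite ler_wpM2l//; apply: (Heta Q Q' nu).
  rewrite mulrCA ler_piMr ?divr_ge0 ?(ltW e0)// ler_pdivrMr// mul1r.
  by rewrite lerDl.
move: (Up Q) (Up Q') pp; rewrite !ler_norml => /andP[? ?] /andP[? ?] /andP[? ?].
by apply/andP; split; lra.
Qed.

(** Balls in [W] are for the sup norm, dual to the l1-norm bounded on [S], so [dotp w x] moves
    little uniformly in [x]. *)
Lemma clipped_utility_continuous Q (C' e : R) : Q S = 1%E ->
  (forall x, S x -> l1norm x <= C') -> 0 < e ->
  exists2 r : R, 0 < r & forall w w', W w -> W w' -> ball w r w' ->
    `|clipped_utility Q w - clipped_utility Q w'| <= e.
Proof.
move=> QS SC e0.
have [s s0 Us] := continuous_segment_unif (- M) M cU e0.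
pose C1 := `|C'| + 1; have C10 : 0 < C1 by rewrite ltr_wpDl.
exists (s / C1) => [|w w' Ww Ww' ww']; first exact: divr_gt0.
rewrite /clipped_utility -bounded_RintegralB//.
apply: (norm_Rintegral_le mS QS); last 2 first.
- exact: ltW.
- move=> x Sx; rewrite !clip_id ?SM//; apply/ltW/Us; first by rewrite -ler_norml SM.
  rewrite dotpBl; apply: (@le_lt_trans _ _ (s / C1 * `|C'|)).
    apply: (le_trans (norm_dotp_le x (K := s / C1) _)).
      by move=> i; rewrite !mxE; apply/ltW; exact: ww'.2.
    apply: ler_wpM2l; first by apply: divr_ge0; apply: ltW.
    exact: (le_trans (SC x Sx) (ler_norm _)).
  rewrite mulrAC ltr_pdivrMr// ltr_pM2l// ltrDl//.
exact: bounded_measurableB.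
Qed.

End utility.

End moments.

(** * Convergence of the robust problem *)

Lemma ae_eventually_summable d (T : measurableType d) (R : realType)
    (P : probability T R) (G : nat -> set T) (b : nat -> R) :
  (forall N, (0 < N)%N -> measurable (G N)) ->
  (forall N, (0 < N)%N -> ((1 - b N)%:E <= P (G N))%E) ->
  (\sum_(1 <= N <oo) (b N)%:E < +oo)%E ->
  {ae P, forall t, \forall N \near \oo, G N t}.
Proof.
move=> mG bG sumb.
(* Nothing is known at index 0, where the empty event and the bound 0 let Borel-Cantelli sum from
   0. *)
pose H N := if (0 < N)%N then ~` G N else set0.
pose c N : \bar R := if (0 < N)%N then (b N)%:E else 0%E.
have mH N : measurable (H N).
  by rewrite /H; case: ifPn => // N0; apply: measurableC; exact: mG.
have Hc N : (P (H N) <= c N)%E.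
  rewrite /H /c; case: ifPn => [N0|_]; last by rewrite measure0.
  rewrite probability_setC; last exact: mG.
  rewrite leeBlDr ?fin_num_measure//; last exact: mG.
  by rewrite -leeBlDl// -EFinB bG.
have sumH : (\sum_(N <oo) P (H N) < +oo)%E.
  rewrite nneseries_recl// (_ : P (H 0%N) = 0%E) ?measure0// add0e.
  apply: le_lt_trans sumb.
  rewrite (_ : (\sum_(1 <= N <oo) (b N)%:E = \sum_(1 <= N <oo) c N)%E).
    by apply: lee_nneseries => //.
  apply/congr_lim/funext => N; apply: eq_big_nat => k /andP[k0 _].
  by rewrite /c k0.
exists (lim_sup_set H); split.
- apply: bigcapT_measurable => k; apply: bigcup_measurable => j _; exact: mH.
- exact: lim_sup_set_cvg0.
move=> t /= tG k _; apply: contra_notP tG => nH.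
exists (maxn k 1) => // N /=; rewrite geq_max => /andP[kN N0].
apply: contra_notP nH => nG; exists N => //.
by rewrite /H N0.
Qed.

Section noise_support.
Context (R : realType) (n : nat) (FE : probability 'rV[R]_n R).
Local Notation Rn := 'rV[R]_n.

(** Noising a point mass exhibits the noise law itself, up to translation; this is how a support
    condition on noisy laws reaches [FE]. *)
Lemma noise_op_dirac (S A : set Rn) (x : Rn) : measurable S -> measurable A ->
  S x -> noise_op FE S (dirac x) A = FE [set z | A (z + x)].
Proof.
move=> mS mA Sx; rewrite noise_opE//; last by rewrite /= diracE mem_set.
have mA' : measurable ((fun p : Rn * Rn => p.2 + p.1) @^-1` A).
  by rewrite -[X in measurable X]setTI; apply: measurable_addrV.
rewrite /product_measure1 integral_dirac//; last exact: (measurable_fun_xsection FE mA').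
rewrite diracT mul1e /=; congr (FE _).
by apply/seteqP; split => z; rewrite /xsection /= inE.
Qed.

Lemma compact_coord_bounded (A : set Rn) : compact A ->
  exists2 K : R, 0 <= K & forall v i, A v -> `|v 0 i| <= K.
Proof.
move=> /compact_bounded[K [_ AK]]; exists (`|K| + 2) => [|v i Av].
  by rewrite addr_ge0.
have : ball (0 : Rn) (`|K| + 2) v.
  rewrite -ball_normE /= sub0r normrN (@le_lt_trans _ _ (`|K| + 1)) ?ltrD2l ?ltr1n//.
  by apply: AK => //; rewrite (le_lt_trans (ler_norm _))// ltrDl.
by move=> [_ /(_ 0 i)]; rewrite mxE /ball /= sub0r normrN => /ltW.
Qed.

Lemma l1norm_le (v : Rn) (K : R) : (forall i, `|v 0 i| <= K) -> l1norm v <= n%:R * K.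
Proof.
move=> vK; rewrite -[n in n%:R]card_ord mulr_natl -sumr_const.
by apply: ler_sum => i _.
Qed.

End noise_support.

(** * Deterministic convergence along one sample path *)

Section noisy_dro.
Context (R : realType) (n : nat) (FE F : probability 'rV[R]_n R).
Local Notation Rn := 'rV[R]_n.
Variables (S Z W : set Rn) (M C : R) (U : R -> R).
Hypotheses (mS : measurable S) (mZ : measurable Z) (FEZ : FE Z = 1%E).
Hypotheses (M0 : 0 < M) (C0 : 0 <= C).
Hypothesis SM : forall w x, W w -> S x -> `|dotp w x| <= M.
Hypothesis ZM : forall w z, W w -> Z z -> `|dotp w z| <= M.
Hypothesis WC : forall w i, W w -> `|w 0 i| <= C.
Hypothesis cU : continuous U.
Hypothesis FS : F S = 1%E.
Variables (eps : nat -> R) (mu : nat -> set Rn -> \bar R).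
Hypothesis eps0 : eps N @[N --> \oo] --> (0 : R).
Hypothesis mu_close : \forall N \near \oo,
  (wasserstein (noise_op FE S F) (mu N) <= (eps N)%:E)%E.

Let dro N := worst_case_utility U (ambiguity FE S (eps N) (mu N)).
Let u := clipped_utility M U F.
Let g := opt_value W (expected_utility U F).

(** Above: [F] itself competes in the infimum. Below: every competitor and [F] have noisy laws
    within [eps N] of the same centre [mu N]. *)
Lemma worst_case_utility_close (e : R) : 0 < e -> \forall N \near \oo,
  forall w, W w -> ((u w - e)%:E <= dro N w <= (u w)%:E)%E.
Proof.
move=> e0.
have [eta eta0 Heta] :=
  clipped_utility_close mS mZ FEZ M0 C0 SM ZM WC cU e0.
have epseta : \forall N \near \oo, eps N < eta.
  by apply: (cvgr_lt 0 eps0).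
near=> N => w Ww.
have epsN : eps N < eta by near: N.
have muN : (wasserstein (noise_op FE S F) (mu N) <= (eps N)%:E)%E by near: N.
apply/andP; split; last first.
  apply: ereal_inf_lbound; exists F => //.
  exact: (expected_utilityE mS M0 SM cU).
apply: le_ereal_inf_tmp => _ [Q [QS wQ] <-].
rewrite (expected_utilityE mS M0 SM cU)// lee_fin lerBlDr -lerBlDl.
apply: le_trans (ler_norm _) _; apply: (Heta F Q (mu N)) => //.
- by rewrite (le_lt_trans muN).
- by rewrite (le_lt_trans wQ).
Unshelve. all: by end_near.
Qed.

Hypothesis W0 : W !=set0.

Lemma opt_value_fin_num : g \is a fin_num.
Proof.
have [K uK] := clipped_utility_bounded n M0 cU.
have [w0 Ww0] := W0.
rewrite fin_numE -ltNye -ltey; apply/andP; split.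
  apply: (@lt_le_trans _ _ (u w0)%:E); first exact: ltNyr.
  apply: ereal_sup_ubound; exists w0 => //.
  exact: (expected_utilityE mS M0 SM cU).
apply: (@le_lt_trans _ _ K%:E); last exact: ltry.
apply: ge_ereal_sup => _ [w Ww <-].
rewrite (expected_utilityE mS M0 SM cU)// lee_fin.
exact: le_trans (ler_norm _) (uK _ _).
Qed.

Lemma opt_value_close (e : R) : 0 < e -> \forall N \near \oo,
  (g - e%:E <= opt_value W (dro N) <= g)%E.
Proof.
move=> /worst_case_utility_close; apply: filterS => N droN.
apply/andP; split.
  rewrite leeBlDr//; apply: ge_ereal_sup => _ [w Ww <-].
  rewrite (expected_utilityE mS M0 SM cU)// -leeBlDr//.
  have /andP[h _] := droN w Ww; apply: (le_trans h).
  by apply: ereal_sup_ubound; exists w.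
apply: ge_ereal_sup => _ [w Ww <-].
have /andP[_ h] := droN w Ww; apply: (le_trans h).
apply: ereal_sup_ubound; exists w => //.
exact: (expected_utilityE mS M0 SM cU).
Qed.

Lemma opt_value_cvg : opt_value W (dro N) @[N --> \oo] --> g.
Proof.
have /fineK gE := opt_value_fin_num.
have bounds (e : R) : 0 < e -> \forall N \near \oo,
    ((fine g - e)%:E <= opt_value W (dro N) <= (fine g)%:E)%E.
  by move=> /opt_value_close; rewrite EFinB gE.
rewrite -gE; apply/fine_cvgP; split.
  apply: filterS (bounds 1 ltr01) => N /andP[h1 h2].
  by rewrite fin_numE -ltNye -ltey (lt_le_trans _ h1) ?ltNyr//= (le_lt_trans h2) ?ltry.
apply/cvgrPdist_le => e e0; apply: filterS (bounds e e0) => N.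
rewrite /=; case: (opt_value _ _) => [r| |]; rewrite ?lee_fin ?leeNy_eq ?leye_eq ?andbF//.
by move=> /andP[h1 h2] /=; rewrite ger0_norm; lra.
Qed.

(** Only the limit objective [u] has to be continuous: [what N] is nearly optimal for [u], and this
    passes to cluster points. *)
Lemma cluster_opt_sols (C' : R) (what : nat -> Rn) : compact W ->
  (forall x, S x -> l1norm x <= C') ->
  (forall N, (0 < N)%N -> opt_sols W (dro N) (what N)) ->
  cluster (what N @[N --> \oo]) `<=` opt_sols W (expected_utility U F).
Proof.
move=> cW SC whatP w /= wcl.
have fW : \forall N \near \oo, W (what N).
  by near=> N; have [] := whatP N; first by near: N; exact: nbhs_infty_gt.
have Ww : W w.
  have clW : closed W by apply: compact_closed => //; exact: norm_hausdorff.
  by apply: clW; move: wcl; rewrite clusterE; apply.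
split => //; apply/eqP; rewrite eq_le; apply/andP; split.
  by apply: ereal_sup_ubound; exists w.
rewrite -/g (expected_utilityE mS M0 SM cU)//.
have /fineK gE := opt_value_fin_num.
rewrite -gE lee_fin; apply/ler_addgt0Pr => e e0.
have e20 : 0 < e / 2 by rewrite divr_gt0.
have [r r0 ur] := clipped_utility_continuous mS M0 SM cU FS SC e20.
have fu : \forall N \near \oo, W (what N) /\ fine g - e / 2 <= u (what N).
  near=> N; have [//|Wh hE] := whatP N; first by near: N; exact: nbhs_infty_gt.
  split => //; rewrite -lee_fin EFinB gE.
  have /andP[h _] : (g - (e / 2)%:E <= opt_value W (dro N) <= g)%E.
    by near: N; exact: opt_value_close.
  apply: (le_trans h); rewrite -hE.
  (* Only the upper bound is wanted, so the tolerance 1 is arbitrary. *)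
  have /(_ _ Wh)/andP[]// : forall w, W w -> ((u w - 1)%:E <= dro N w <= (u w)%:E)%E.
  by near: N; exact: worst_case_utility_close.
have [w' [[Ww' gw'] ww']] := wcl [set w' | W w' /\ fine g - e / 2 <= u w'] _ fu
  (nbhsx_ballx w r r0).
have : `|u w - u w'| <= e / 2 by exact: ur.
rewrite ler_norml => /andP[h1 h2]; rewrite -[leRHS]/(u w + e).
by move: (u w) (u w') gw' h1 h2 => a b /=; lra.
Unshelve. all: by end_near.
Qed.

End noisy_dro.

Theorem theorem3p3 (R : realType) (n : nat)
  (xmin xmax : 'rV[R]_n) (Xstar : set 'rV[R]_n)
  (Xstar_compact : compact Xstar) (Xstar_convex : convex_set Xstar)
  (box_Xstar : box xmin xmax `<=` Xstar)
  (F FE : probability 'rV[R]_n R) (F_box : prob_on (box xmin xmax) F)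
  (noise_Xstar : forall Q : probability 'rV[R]_n R,
    prob_on (box xmin xmax) Q -> noise_op FE (box xmin xmax) Q Xstar = 1%E)
  (d : measure_display) (Om : measurableType d) (P : probability Om R)
  (Xhat : nat -> {RV P >-> 'rV[R]_n})
  (Xhat_iid : iid_from Xhat (noise_op FE (box xmin xmax) F))
  (W : set 'rV[R]_n) (W_compact : compact W)
  (U : R -> R) (U_continuous : continuous U)
  (U_concave : convex_function [set: R^o] (fun x : R^o => - U x : R^o))
  (U_nondecreasing : {homo U : x y / x <= y})
  (beta : nat -> R) (beta01 : forall N, (0 < N)%N -> 0 < beta N < 1)
  (beta_summable : (\sum_(1 <= N <oo) (beta N)%:E < +oo)%E)
  (eps : nat -> R)
  (eps_radius : forall N, (0 < N)%N ->
    is_radius P Xhat (noise_op FE (box xmin xmax) F) N (beta N) (eps N))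
  (eps_cvg : eps N @[N --> \oo] --> (0 : R))
  (L : R)
  (utility_lipschitz : forall w, W w ->
    lipschitz_l1 L (box xmin xmax) (fun x => U (dotp w x))) :
  let dro N om := worst_case_utility U
    (ambiguity FE (box xmin xmax) (eps N) (empirical (Xhat ^~ om) N)) in
  let gSO := opt_value W (expected_utility U F) in
  forall what : nat -> Om -> 'rV[R]_n,
    (forall N om, (0 < N)%N -> opt_sols W (dro N om) (what N om)) ->
    {ae P, forall om, opt_value W (dro N om) @[N --> \oo] --> gSO} /\
    {ae P, forall om, cluster (what N om @[N --> \oo]) `<=`
      opt_sols W (expected_utility U F)}.
Proof.
move=> dro gSO what whatP.
have mX : measurable Xstar.
  apply: closed_measurable_rV; apply: compact_closed => //; exact: norm_hausdorff.
have mbox : measurable (box xmin xmax) by exact: measurable_box.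
have FS : F (box xmin xmax) = 1%E by [].
have [x0 x0box] : box xmin xmax !=set0.
  apply/set0P/eqP => b0; move: FS; rewrite b0 measure0 => /eqP.
  by rewrite eqe eq_sym oner_eq0.
(* Noise added to the point [x0] of the box must land in [Xstar], so the noise is carried by this
   bounded translate. *)
pose Z := [set z : 'rV[R]_n | Xstar (z + x0)].
have mZ : measurable Z.
  rewrite -[X in measurable X]setTI.
  have mf : measurable_fun setT (fun z : 'rV[R]_n => z + x0).
    by apply: measurable_addrV => //; exact: measurable_cst.
  exact: (mf measurableT Xstar mX).
have FEZ : FE Z = 1%E.
  rewrite -(noise_op_dirac FE mbox mX x0box); apply: noise_Xstar.
  by rewrite /prob_on /= diracE mem_set.
have [C C0 WC] := compact_coord_bounded W_compact.
have [K K0 XK] := compact_coord_bounded Xstar_compact.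
have boxK x i : box xmin xmax x -> `|x 0 i| <= K by move=> /box_Xstar /XK.
(* Noise coordinates are differences of coordinates of points of [Xstar], whence [K + K]; the 1
   makes [M] positive. *)
pose M := C * (n%:R * (K + K)) + 1.
have KK0 : 0 <= K + K by rewrite addr_ge0.
have nK0 : 0 <= n%:R * (K + K) :> R by rewrite mulr_ge0.
have M0 : 0 < M by rewrite ltr_wpDl// mulr_ge0.
have dotM w (x : 'rV[R]_n) : W w -> (forall i, `|x 0 i| <= K + K) -> `|dotp w x| <= M.
  move=> Ww xK; apply: (@le_trans _ _ (C * (n%:R * (K + K)))); last by rewrite lerDl.
  rewrite (le_trans (norm_dotp_le _ (WC w ^~ Ww)))// ler_wpM2l//.
  exact: l1norm_le.
have SM w x : W w -> box xmin xmax x -> `|dotp w x| <= M.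
  by move=> Ww xS; apply: dotM => // i; rewrite (le_trans (boxK x i xS))// lerDl.
have ZM w z : W w -> Z z -> `|dotp w z| <= M.
  move=> Ww Zz; apply: dotM => // i.
  rewrite -(addrK (x0 0 i) (z 0 i)) (le_trans (ler_normB _ _))// lerD ?boxK//.
  by have := XK _ i Zz; rewrite mxE.
have close : {ae P, forall om, \forall N \near \oo,
    (wasserstein (noise_op FE (box xmin xmax) F)
      (empirical (Xhat ^~ om) N) <= (eps N)%:E)%E}.
  apply: (@ae_eventually_summable _ _ _ P (fun N => [set om |
    (wasserstein (noise_op FE (box xmin xmax) F)
      (empirical (Xhat ^~ om) N) <= (eps N)%:E)%E]) beta) => //.
  - by move=> N N0; apply: measurable_wasserstein_empirical.
  - by move=> N /eps_radius[].
(* A probability space has a point, and there the given optimal solution for [N = 1] lies in [W]. *)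
have W0 : W !=set0.
  have [om] : [set: Om] !=set0.
    apply/set0P/eqP => T0; have := probability_setT P.
    by rewrite T0 measure0 => /eqP; rewrite eqe eq_sym oner_eq0.
  by have [//|Ww _] := whatP 1%N om; exists (what 1%N om).
split; apply: filterS close => om omP.
  exact: (opt_value_cvg mbox mZ FEZ M0 C0 SM ZM WC U_continuous FS eps_cvg omP W0).
apply: (cluster_opt_sols mbox mZ FEZ M0 C0 SM ZM WC U_continuous FS eps_cvg omP W0
  W_compact (C' := n%:R * K)).
  by move=> x xS; apply: l1norm_le => i; exact: boxK.
by move=> N N0; exact: whatP.
Qed.
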